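(* Let $(X_n)_{n\ge1}$ be a sequence of nonnegative independent random variables (not necessarily identically distributed) and let $(r_n)_{n\ge1}$ be a sequence of natural numbers with $r_n<n$, tending to $\infty$ and with $r_n=o(n)$. Let $(t_n)_{n\ge1}$ be a sequence of positive real numbers, and put $$d_n=\sum_{k=1}^nE\big[X_k1_{\{X_k\le t_n\}}\big],\qquad A_n=\sum_{k=1}^nP(X_k>t_n).$$ Assume that there exists $C_0>0$ such that $\sum_n\exp\big(-C\frac{d_n^2}{nt_n^2}\big)<+\infty$ for all $0<C<C_0$, and that there exists $c_0>0$ such that $\sum_n\exp(-cA_n)<+\infty$ for all $0<c<c_0$. Assume that there exists $\varepsilon_0>0$ such that $$r_n\ge\lceil(1+\varepsilon_0)A_n\rceil$$ for $n$ large enough. Moreover, assume that $$\limsup_{n\to\infty}\frac{A_nt_n}{d_n}<\infty\qquad\text{and}\qquad\lim_{n\to\infty}\frac{(r_n-A_n)t_n}{d_n}=0.$$ Then $$\lim_{n\to\infty}\frac{S_n^{r_n}}{d_n}=1\quad\text{almost surely.}$$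
   Context: For each $n$ let $\sigma$ be a (random) permutation of $\{1,\dots,n\}$ with $X_{\sigma(1)}\ge X_{\sigma(2)}\ge\dots\ge X_{\sigma(n)}$; the trimmed sum is $S_n^{r_n}=\sum_{k=r_n+1}^nX_{\sigma(k)}$. *)

(* Defs.v *)
From HB Require Import structures.
From mathcomp Require Export all_boot all_order all_algebra all_fingroup finmap.
From mathcomp Require Export all_classical all_reals all_analysis.

Set Implicit Arguments.
Unset Strict Implicit.
Unset Printing Implicit Defensive.

Import Order.TTheory GRing.Theory Num.Theory.
Import numFieldNormedType.Exports.

Local Open Scope classical_set_scope.
Local Open Scope ring_scope.

(* Random variables are indexed from 0: [X k] is the variable usually written
   X_(k+1), and the first n variables are the [X k] with [k : 'I_n].  The index
   n of partial sums and of deterministic sequences is not shifted. *)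

(* For measure-valued quantities, [fine] is harmless below: probabilities and
   expectations of bounded nonnegative variables are finite. *)

Definition mutually_independent d (T : measurableType d) (R : realType)
    (P : probability T R) (X : nat -> {RV P >-> R}) : Prop :=
  forall (J : {fset nat}) (B : nat -> set R),
    (forall k, measurable (B k)) ->
    P (\bigcap_(k in [set` J]) (X k @^-1` B k)) =
    (\prod_(k <- J) P (X k @^-1` B k))%E.

Definition truncated_mean_sum d (T : measurableType d) (R : realType)
    (P : probability T R) (X : nat -> {RV P >-> R}) (t : nat -> R) (n : nat) : R :=
  \sum_(k < n)
    fine 'E_P[(fun w => X k w * \1_[set w' | X k w' <= t n] w)%R].

Definition tail_prob_sum d (T : measurableType d) (R : realType)
    (P : probability T R) (X : nat -> {RV P >-> R}) (t : nat -> R) (n : nat) : R :=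
  \sum_(k < n) fine (P [set w | t n < X k w]).

Definition sorts_decreasingly d (T : measurableType d) (R : realType)
    (P : probability T R) (X : nat -> {RV P >-> R}) (n : nat) (sigma : T -> 'S_n) :
    Prop :=
  forall (w : T) (i j : 'I_n), (i <= j)%N -> X (sigma w j) w <= X (sigma w i) w.

(* Since positions are counted from 0, those with [r <= k] are what remains
   after discarding the first r. *)
Definition trimmed_sum d (T : measurableType d) (R : realType)
    (P : probability T R) (X : nat -> {RV P >-> R}) (n : nat) (sigma : T -> 'S_n)
    (r : nat) (w : T) : R :=
  \sum_(k < n | (r <= k)%N) X (sigma w k) w.

(* Main.v *)
Require Import Defs.
From mathcomp Require Import measurable_realfun.
From mathcomp Require Import ring lra.

Set Implicit Arguments.
Unset Strict Implicit.
Unset Printing Implicit Defensive.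

Import Order.TTheory GRing.Theory Num.Theory.
Import numFieldNormedType.Exports.
Import HBNNSimple.

Local Open Scope classical_set_scope.
Local Open Scope ring_scope.

(** Why the theorem holds. Cut every variable at the level t_n: let T_n be the
    sum of the X_k with X_k <= t_n, of mean d_n, and let N_n be the number of
    the X_k above t_n, of mean A_n. Once N_n <= r_n, trimming removes all the
    variables above t_n together with r_n - N_n variables that lie between 0
    and t_n, so that
      T_n - (r_n - N_n) t_n <= S_n^{r_n} <= T_n
    ([trimmed_sum_bounds]). It therefore suffices that T_n / d_n -> 1 and
    N_n / A_n -> 1 almost surely: the second limit and the margin eps_0 give
    N_n <= r_n eventually, and
      (r_n - N_n) t_n / d_n
        = (r_n - A_n) t_n / d_n + (1 - N_n / A_n) (A_n t_n / d_n)
    tends to 0, the last factor being bounded ([trimmed_ratio_cvg1]).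

    Both limits are instances of one law of large numbers for triangular
    arrays, [ae_ratio_cvg1]: if the rows consist of independent variables with
    values in [0, 1], and if the sums of exp(- c mu_n) are finite for small c,
    where mu_n is the mean of the n-th row sum S_n, then S_n / mu_n -> 1 almost
    surely. This follows by Borel-Cantelli from the multiplicative Chernoff
    bound
      P(|S_n - mu_n| >= 4 l mu_n) <= 2 exp(- 2 l^2 mu_n)
    ([chernoff_sum_two_sided]). For N_n the row mean is A_n itself. For T_n,
    rescaled by t_n, it is mu_n = d_n / t_n; as mu_n <= n one has
    d_n^2 / (n t_n^2) = mu_n^2 / n <= mu_n, so the hypothesis on d_n yields the
    summability. A bound relative to the mean thus replaces Hoeffding's
    inequality and serves both purposes.

    The Chernoff bound needs the expectation of a product of functions of
    independent variables ([integral_prod_indep]), while independence is given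
    on events. Indicators are replaced by functions one coordinate at a time:
    for a fixed weight W, the set function B |-> E[W 1_B(X)] determines
    E[W f(X)] for every nonnegative f ([integral_weight_ext]). *)

(** * Expectation of a product of independent factors *)

Lemma integral_simple_comp d (T : measurableType d) (R : realType)
    (P : probability T R) (X : {RV P >-> R}) (W : T -> R) (h : {nnsfun R >-> R}) :
  (forall w, 0 <= W w) -> measurable_fun [set: T] W ->
  (\int[P]_w (W w * h (X w))%:E =
   \sum_(r \in range h) r%:E * \int[P]_w (W w * \1_(h @^-1` [set r]) (X w))%:E)%E.
Proof.
move=> W0 mW.
have m1 r : measurable_fun [set: T]
    (fun w => W w * \1_(h @^-1` [set r]) (X w)).
  apply: measurable_funM => //.
  by apply: (measurable_comp measurableT) => //; exact: measurable_indic.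
have h1 r w : (0 <= (W w * \1_(h @^-1` [set r]) (X w))%:E)%E.
  by rewrite lee_fin mulr_ge0.
have h2 r w : (0 <= r%:E * (W w * \1_(h @^-1` [set r]) (X w))%:E)%E.
  by rewrite EFinM muleCA mule_ge0 ?lee_fin//; exact: nnfun_muleindic_ge0.
transitivity (\int[P]_w (\sum_(r \in range h)
   r%:E * (W w * \1_(h @^-1` [set r]) (X w))%:E))%E.
  apply: eq_integral => w _.
  rewrite fimfunE EFinM -fsumEFin// ge0_mule_fsumr; last first.
    by move=> r; rewrite EFinM nnfun_muleindic_ge0.
  by apply: eq_fsbigr => r _; rewrite -EFinM -EFinM mulrCA.
rewrite ge0_integral_fsum//.
- apply: eq_fsbigr => r /[1!inE] -[y _ <-]; rewrite ge0_integralZl//.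
    exact/measurable_EFinP.
  by rewrite lee_fin.
- by move=> r; apply: measurable_funeM; exact/measurable_EFinP.
Qed.

(** Two weights that give the same integrals to all the indicators of X give
    the same integrals to all nonnegative functions of X: this is clear for
    simple functions by linearity, and extends by monotone convergence. *)
Lemma integral_weight_ext d (T : measurableType d) (R : realType)
    (P : probability T R) (X : {RV P >-> R}) (V W : T -> R) (f : R -> R) :
  (forall w, 0 <= V w) -> measurable_fun [set: T] V ->
  (forall w, 0 <= W w) -> measurable_fun [set: T] W ->
  (forall x, 0 <= f x) -> measurable_fun [set: R] f ->
  (forall B, measurable B ->
    (\int[P]_w (V w * \1_B (X w))%:E = \int[P]_w (W w * \1_B (X w))%:E)%E) ->
  (\int[P]_w (V w * f (X w))%:E = \int[P]_w (W w * f (X w))%:E)%E.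
Proof.
move=> V0 mV W0 mW f0 mf VW.
have mfE : measurable_fun [set: R] (EFin \o f) by exact/measurable_EFinP.
pose h := nnsfun_approx measurableT mfE.
have lim_int (U : T -> R) : (forall w, 0 <= U w) -> measurable_fun [set: T] U ->
    (\int[P]_w (U w * f (X w))%:E =
     limn (fun n => \int[P]_w (U w * h n (X w))%:E))%E.
  move=> U0 mU; rewrite -monotone_convergence//.
  - apply: eq_integral => w _; apply/esym/cvg_lim => //.
    under eq_fun do rewrite EFinM.
    rewrite EFinM; apply: cvgeZl => //.
    by apply: (cvg_nnsfun_approx measurableT mfE) => // x _; rewrite lee_fin.
  - move=> n; apply/measurable_EFinP; apply: measurable_funM => //.
    exact: (measurable_comp measurableT).
  - by move=> n w _; rewrite lee_fin mulr_ge0.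
  - move=> w _ m n mn; rewrite lee_fin ler_wpM2l//.
    exact/lefP/nd_nnsfun_approx.
rewrite !lim_int//; apply: congr_lim; apply/funext => n.
by rewrite !integral_simple_comp//; apply: eq_fsbigr => r _; rewrite VW.
Qed.

Lemma integral_indic_comp d (T : measurableType d) (R : realType)
    (P : probability T R) (X : {RV P >-> R}) (B : set R) :
  measurable B -> (\int[P]_w (\1_B (X w))%:E = P (X @^-1` B))%E.
Proof.
move=> mB; have mXB : measurable (X @^-1` B).
  by rewrite -[X in measurable X]setTI; exact: measurable_funP.
by rewrite -[X @^-1` B]setIT -integral_indic.
Qed.

Lemma integral_indic_comp_lty d (T : measurableType d) (R : realType)
    (P : probability T R) (X : {RV P >-> R}) (B : set R) :
  measurable B -> (\int[P]_w (\1_B (X w))%:E < +oo)%E.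
Proof.
move=> mB; rewrite integral_indic_comp//.
apply: le_lt_trans (ltry 1); apply: probability_le1.
by rewrite -[X in measurable X]setTI; exact: measurable_funP.
Qed.

Lemma integral_prod_indic d (T : measurableType d) (R : realType)
    (P : probability T R) (X : nat -> {RV P >-> R}) (B : nat -> set R) n :
  mutually_independent X -> (forall k, measurable (B k)) ->
  (\int[P]_w (\prod_(k < n) \1_(B k) (X k w))%:E =
   \prod_(k < n) \int[P]_w (\1_(B k) (X k w))%:E)%E.
Proof.
move=> indX mB.
have mXB k : measurable (X k @^-1` B k).
  by rewrite -[X in measurable X]setTI; exact: measurable_funP.
pose J := seq_fset tt (iota 0 n).
have bigJ (S : Type) (idx : S) (op : Monoid.com_law idx) (F : nat -> S) :
    \big[op/idx]_(k <- J) F k = \big[op/idx]_(k < n) F k.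
  rewrite -(big_mkord xpredT F) /index_iota subn0; apply: perm_big.
  by rewrite (perm_trans (seq_fset_perm _ _))// undup_id ?iota_uniq.
transitivity (\int[P]_w (\1_(\bigcap_(k in [set` J]) (X k @^-1` B k)) w)%:E)%E.
  apply: eq_integral => w _; congr EFin.
  rewrite -(bigJ _ _ _ (fun k => \1_(B k) (X k w))).
  rewrite indicE; have [wB|wB] := boolP (w \in _).
    rewrite big_seq big1// => k kJ; rewrite indicE mem_set//.
    by move: wB; rewrite inE => /(_ k kJ).
  apply/eqP; rewrite prodf_seq_eq0; apply/negPn/negP => /hasPn nB0.
  move/negP: wB; apply; rewrite inE => k kJ.
  by have := nB0 _ kJ; rewrite indicE /= pnatr_eq0 eqb0 negbK inE.
rewrite integral_indic//; last exact: fin_bigcap_measurable.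
rewrite setIT; transitivity (\prod_(k <- J) P (X k @^-1` B k))%E; first exact: indX.
rewrite bigJ; apply: eq_bigr => k _.
by rewrite integral_indic_comp.
Qed.

(** The factors of index at least [m] are still indicators; the induction on
    [m] lets them become arbitrary one by one. *)
Lemma integral_prod_indep_from d (T : measurableType d) (R : realType)
    (P : probability T R) (X : nat -> {RV P >-> R}) n m (f : nat -> R -> R) :
  mutually_independent X -> (m <= n)%N ->
  (forall k x, 0 <= f k x) -> (forall k, measurable_fun [set: R] (f k)) ->
  (forall k, \int[P]_w (f k (X k w))%:E < +oo)%E ->
  (forall k, (m <= k)%N -> exists2 B, measurable B & f k = \1_B) ->
  (\int[P]_w (\prod_(k < n) f k (X k w))%:E =
   \prod_(k < n) \int[P]_w (f k (X k w))%:E)%E.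
Proof.
move=> indX; elim: m f => [|m IH] f mn f0 mf foo fB.
  have /choice[B mB] : forall k, exists B, measurable B /\ f k = \1_B.
    by move=> k; have [B ? ?] := fB k isT; exists B.
  have -> : f = fun k => \1_(B k) by apply/funext => k; rewrite (mB k).2.
  by apply: integral_prod_indic => // k; exact: (mB k).1.
pose o := Ordinal mn.
(* By the induction hypothesis, the other factors [W] act on the indicators of
   [X m] as the constant [c], hence also on [f m]. *)
pose fI B k := if k == m then \1_B else f k.
have fIm B : fI B m = \1_B by rewrite /fI eqxx.
pose W w := \prod_(k < n | k != o) f k (X k w).
pose c := \prod_(k < n | k != o) fine (\int[P]_w (f k (X k w))%:E).
have mfX k : measurable_fun [set: T] (fun w => f k (X k w)).
  exact: (measurable_comp measurableT).
have W0 w : 0 <= W w by apply: prodr_ge0.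
have mW : measurable_fun [set: T] W.
  by rewrite /W; under eq_fun do rewrite -big_filter; exact: measurable_prod.
have I0 k : (0 <= \int[P]_w (f k (X k w))%:E)%E.
  by apply: integral_ge0 => w _; rewrite lee_fin.
have c0 : 0 <= c by apply: prodr_ge0 => k _; rewrite fine_ge0.
have cE : c%:E = (\prod_(k < n | k != o) \int[P]_w (f k (X k w))%:E)%E.
  rewrite /c; elim/big_ind2: _ => // [x y x' y' <- <-//|k _].
  by rewrite fineK// ge0_fin_numE.
have key B : measurable B -> (\int[P]_w (W w * \1_B (X m w))%:E =
    \int[P]_w (c * \1_B (X m w))%:E)%E.
  move=> mB; under [RHS]eq_integral do rewrite EFinM.
  rewrite ge0_integralZl//; last first.
    apply/measurable_EFinP; apply: (measurable_comp measurableT) => //;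
      exact: measurable_indic.
  have := IH (fI B) (ltnW mn); rewrite (bigD1 o)//= => IHI.
  transitivity (\int[P]_w (\prod_(k < n) fI B k (X k w))%:E)%E.
    apply: eq_integral => w _; rewrite (bigD1 o)//= fIm mulrC; congr (_ * _)%:E.
    by apply: eq_bigr => k; rewrite /fI -val_eqE => /negbTE ->.
  rewrite IHI.
  - rewrite fIm muleC cE; congr (_ * _)%E.
    by apply: eq_bigr => k; rewrite /fI -val_eqE => /negbTE ->.
  - by move=> k x; rewrite /fI; case: ifP.
  - by move=> k; rewrite /fI; case: ifP => // _; exact: measurable_indic.
  - move=> k; rewrite /fI; case: ifP => // _.
    exact: integral_indic_comp_lty.
  - move=> k mk; rewrite /fI; case: eqP => [_|/eqP km]; first by exists B.
    by apply: fB; rewrite ltn_neqAle eq_sym km.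
transitivity (\int[P]_w (W w * f m (X m w))%:E)%E.
  by apply: eq_integral => w _; rewrite (bigD1 o)//= mulrC.
rewrite (integral_weight_ext (W := fun=> c))//.
under eq_integral do rewrite EFinM.
rewrite ge0_integralZl//; [|exact/measurable_EFinP|by move=> w _; rewrite lee_fin].
by rewrite [RHS](bigD1 o)//= muleC cE.
Qed.

Lemma integral_prod_indep d (T : measurableType d) (R : realType)
    (P : probability T R) (X : nat -> {RV P >-> R}) n (f : nat -> R -> R) :
  mutually_independent X ->
  (forall k x, 0 <= f k x) -> (forall k, measurable_fun [set: R] (f k)) ->
  (forall k, \int[P]_w (f k (X k w))%:E < +oo)%E ->
  (\int[P]_w (\prod_(k < n) f k (X k w))%:E =
   \prod_(k < n) \int[P]_w (f k (X k w))%:E)%E.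
Proof.
move=> indX f0 mf foo.
pose f' k := if (k < n)%N then f k else \1_setT.
have f'E (k : 'I_n) : f' k = f k by rewrite /f' ltn_ord.
under eq_integral do under eq_bigr do rewrite -f'E.
under [RHS]eq_bigr do rewrite -f'E.
apply: (integral_prod_indep_from indX (leqnn n)) => k; rewrite /f';
  case: ifPn => //.
- by move=> _; exact: integral_indic_comp_lty.
- by rewrite ltnNge => /negP nk /nk.
- by move=> _ _; exists setT.
Qed.

(** * A multiplicative Chernoff bound *)

(** From exp(-l) >= 1 - l one gets exp(l) <= 1 / (1 - l), and the right-hand
    side is at least this quotient: multiplied by 1 - l it becomes
    1 + l^2 (1 - 2 l). *)
Lemma expR_le_quadratic (R : realType) (l : R) :
  l <= 2^-1 -> expR l <= 1 + l + 2 * l ^+ 2.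
Proof.
move=> l2.
have h : (1 - l) * expR l <= 1.
  by rewrite -ler_pdivlMr ?expR_gt0// div1r -expRN expR_ge1Dx.
have l3 : 0 <= l ^+ 2 * (1 - 2 * l) by rewrite mulr_ge0 ?sqr_ge0//; lra.
rewrite -(ler_pM2l (_ : 0 < 1 - l)); last lra.
apply: (le_trans h); nra.
Qed.

Lemma expR_le_chord (R : realType) (l z : R) :
  0 <= z <= 1 -> expR (l * z) <= 1 + (expR l - 1) * z.
Proof.
move=> /andP[z0 z1].
have := convex_expR (Itv01 z0 z1) l 0.
rewrite !convRE /= expR0 mulr0 addr0 mulr1 mulrC => /le_trans; apply.
by rewrite /unstable.onem; lra.
Qed.

Lemma integrable_unit_valued d (T : measurableType d) (R : realType)
    (P : probability T R) (Y : T -> R) :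
  measurable_fun [set: T] Y -> (forall w, 0 <= Y w <= 1) ->
  P.-integrable [set: T] (EFin \o Y).
Proof.
move=> mY Y01; apply: measurable_bounded_integrable => //.
  by apply: le_lt_trans (ltry 1); exact: probability_le1.
exists 1; split => // x x1 w _; have /andP[? ?] := Y01 w.
by rewrite /= ger0_norm// (le_trans _ (ltW x1)).
Qed.

Lemma mean_unit_valued d (T : measurableType d) (R : realType)
    (P : probability T R) (Y : T -> R) :
  measurable_fun [set: T] Y -> (forall w, 0 <= Y w <= 1) ->
  0 <= fine (\int[P]_w (Y w)%:E)%E <= 1.
Proof.
move=> mY Y01; have iY := integrable_unit_valued P mY Y01.
have Y0 : (0 <= \int[P]_w (Y w)%:E)%E.
  by apply: integral_ge0 => w _; rewrite lee_fin; case/andP: (Y01 w).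
rewrite fine_ge0//= -lee_fin fineK ?integral_fune_fin_num//.
apply: (@le_trans _ _ (\int[P]_w (cst 1 w))%E).
  apply: ge0_le_integral => //.
  - by move=> w _; rewrite lee_fin; case/andP: (Y01 w).
  - exact/measurable_EFinP.
  - by move=> w _; rewrite lee_fin; case/andP: (Y01 w).
by rewrite integral_cst// mul1e; exact: probability_le1.
Qed.

(** Replacing the exponential by its chord over [0, 1] makes the integrand
    affine in Y, so that only the mean of Y matters; then 1 + x <= exp(x)
    prepares the product over independent variables. *)
Lemma integral_expR_le d (T : measurableType d) (R : realType)
    (P : probability T R) (Y : T -> R) (l : R) :
  measurable_fun [set: T] Y -> (forall w, 0 <= Y w <= 1) ->
  (\int[P]_w (expR (l * Y w))%:E <=
   (expR (fine (\int[P]_w (Y w)%:E) * (expR l - 1)))%:E)%E.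
Proof.
move=> mY Y01.
have iY := integrable_unit_valued P mY Y01.
pose a := expR l - 1.
have ma : measurable_fun [set: T] (fun w => 1 + a * Y w).
  apply: measurable_funD => //; exact: measurable_funM.
apply: (@le_trans _ _ (\int[P]_w (1 + a * Y w)%:E)%E).
  apply: ge0_le_integral => //.
  - apply/measurable_EFinP; apply: measurableT_comp => //; exact: measurable_funM.
  - exact/measurable_EFinP.
  - by move=> w _; rewrite lee_fin; exact: expR_le_chord.
have -> : (\int[P]_w (1 + a * Y w)%:E = 1 + a%:E * \int[P]_w (Y w)%:E)%E.
  rewrite -integralZl//.
  transitivity (\int[P]_w (cst 1 w + a%:E * (Y w)%:E))%E; first by [].
  rewrite integralD//.
  - by rewrite integral_cst// mul1e; congr (_ + _)%E; exact: probability_setT.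
  - exact: finite_measure_integrable_cst.
  - exact: integrableZl.
rewrite -[(\int[P]_w (Y w)%:E)%E]fineK ?integral_fune_fin_num//.
by rewrite -EFinM lee_fin fineK ?integral_fune_fin_num// mulrC expR_ge1Dx.
Qed.

Lemma integral_expR_sum_le d (T : measurableType d) (R : realType)
    (P : probability T R) (X : nat -> {RV P >-> R}) (g : nat -> R -> R) n (l : R) :
  mutually_independent X ->
  (forall k, measurable_fun [set: R] (g k)) ->
  (forall k w, 0 <= g k (X k w) <= 1) ->
  (\int[P]_w (expR (l * \sum_(k < n) g k (X k w)))%:E <=
   (expR (\sum_(k < n) fine (\int[P]_w (g k (X k w))%:E) * (expR l - 1)))%:E)%E.
Proof.
move=> indX mg g01.
have mgX k : measurable_fun [set: T] (fun w => g k (X k w)).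
  exact: measurableT_comp.
have bnd k := integral_expR_le P l (mgX k) (g01 k).
under eq_integral do rewrite mulr_sumr expR_sum.
rewrite (@integral_prod_indep _ _ _ _ _ n (fun k x => expR (l * g k x)))//.
- rewrite expR_sum.
  suff: (0 <= \prod_(k < n) \int[P]_w (expR (l * g k (X k w)))%:E <=
     (\prod_(k < n) expR (fine (\int[P]_w (g k (X k w))%:E) * (expR l - 1)))%:E)%E.
    by case/andP.
  elim/big_ind2: _ => [|x y x' y' /andP[x0 xy] /andP[x'0 xy']|k _].
  + by rewrite lee01 lexx.
  + by rewrite EFinM mule_ge0// lee_pmul.
  + by rewrite bnd integral_ge0// => w _; rewrite lee_fin expR_ge0.
- move=> k; apply: measurableT_comp => //; exact: measurable_funM.
- by move=> k; apply: le_lt_trans (bnd k) _; exact: ltry.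
Qed.

(** Markov's inequality for exp(l S). The sign of [l] selects the tail, and
    the deviation 4 |l| mu is tuned to [l]: the exponent is at most
    mu (exp(l) - 1 - l - 4 l^2) <= mu (2 l^2 - 4 l^2). *)
Lemma chernoff_sum d (T : measurableType d) (R : realType)
    (P : probability T R) (X : nat -> {RV P >-> R}) (g : nat -> R -> R) n (l : R) :
  mutually_independent X ->
  (forall k, measurable_fun [set: R] (g k)) ->
  (forall k w, 0 <= g k (X k w) <= 1) ->
  l <= 2^-1 ->
  let mu := \sum_(k < n) fine (\int[P]_w (g k (X k w))%:E)%E in
  (P [set w | (4 * l ^+ 2 * mu <= l * (\sum_(k < n) g k (X k w) - mu))%R] <=
   (expR (- (2 * l ^+ 2 * mu)))%:E)%E.
Proof.
move=> indX mg g01 l2; set mu := (X in let mu := X in _); rewrite /=.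
have mgX k : measurable_fun [set: T] (fun w => g k (X k w)).
  exact: measurableT_comp.
have mu0 : 0 <= mu.
  by apply: sumr_ge0 => k _; case/andP: (mean_unit_valued P (mgX k) (g01 k)).
pose S w := \sum_(k < n) g k (X k w).
have mS : measurable_fun [set: T] S by exact: measurable_sum.
set E := [set w | _].
have mE : measurable E.
  rewrite /E -[X in measurable X]setTI; apply: measurable_fun_le => //.
  by apply: measurable_funM => //; exact: measurable_funB.
(* The event is that exp(l S - b) >= 1. *)
pose b := l * mu + 4 * l ^+ 2 * mu.
have mlS : measurable_fun [set: T] (fun w => expR (l * S w)).
  by apply: measurableT_comp => //; exact: measurable_funM.
rewrite -[E]setIT -integral_indic//.
apply: (@le_trans _ _ (\int[P]_w ((expR (- b))%:E * (expR (l * S w))%:E))%E).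
  apply: ge0_le_integral => //.
  - exact/measurable_EFinP/measurable_indic.
  - apply/measurable_EFinP; exact: measurable_funM.
  - move=> w _; rewrite -EFinM -expRD lee_fin indicE.
    have [|_] := boolP (w \in E); last exact: expR_ge0.
    rewrite inE /E /= -/(S w) => wE.
    by rewrite -[leLHS]expR0 ler_expR /b; lra.
rewrite ge0_integralZl//; last exact/measurable_EFinP.
apply: le_trans (lee_wpmul2l _ (integral_expR_sum_le n l indX mg g01)) _ => //.
rewrite -EFinM lee_fin -expRD ler_expR -mulr_suml -/mu.
have := expR_le_quadratic l2.
move: (expR l) => e he.
have : mu * e <= mu * (1 + l + 2 * l ^+ 2) by exact: ler_wpM2l.
by rewrite /b; lra.
Qed.

Lemma chernoff_sum_two_sided d (T : measurableType d) (R : realType)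
    (P : probability T R) (X : nat -> {RV P >-> R}) (g : nat -> R -> R) n (l : R) :
  mutually_independent X ->
  (forall k, measurable_fun [set: R] (g k)) ->
  (forall k w, 0 <= g k (X k w) <= 1) ->
  0 < l <= 2^-1 ->
  let mu := \sum_(k < n) fine (\int[P]_w (g k (X k w))%:E)%E in
  (P [set w | (4 * l * mu <= `|\sum_(k < n) g k (X k w) - mu|)%R] <=
   (2 * expR (- (2 * l ^+ 2 * mu)))%:E)%E.
Proof.
move=> indX mg g01 /andP[l0 l2]; set mu := (X in let mu := X in _); rewrite /=.
have l2n : - l <= 2^-1 by lra.
have mgX k : measurable_fun [set: T] (fun w => g k (X k w)).
  exact: measurableT_comp.
pose S w := \sum_(k < n) g k (X k w).
have mS : measurable_fun [set: T] S by exact: measurable_sum.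
pose E a := [set w | 4 * a ^+ 2 * mu <= a * (S w - mu)].
have mE a : measurable (E a).
  rewrite /E -[X in measurable X]setTI; apply: measurable_fun_le => //.
  by apply: measurable_funM => //; exact: measurable_funB.
rewrite [X in P X](_ : _ = E l `|` E (- l)).
  apply: (le_trans (measureU2 _ _ _)) => //.
  rewrite mulrDl mul1r EFinD leeD//; first exact: (chernoff_sum n indX mg g01 l2).
  by rewrite -(sqrrN l); exact: (chernoff_sum n indX mg g01 l2n).
apply/seteqP; split => w; rewrite /E /= -/(S w) ler_normr sqrrN mulNr -mulrN.
- have -> : 4 * l ^+ 2 * mu = l * (4 * l * mu) by ring.
  by rewrite !ler_pM2l// => /orP.
- have -> : 4 * l ^+ 2 * mu = l * (4 * l * mu) by ring.
  by rewrite !ler_pM2l// => /orP.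
Qed.

(** * Almost sure equivalence of a row sum and its mean *)

(** Borel-Cantelli for the deviations 4 l_m mu_n, along a sequence l_m that
    tends to 0 and starts low enough for the Chernoff exponent 2 l_m^2 to stay
    below [c0]. Rows with mu_n = 0 belong to the exceptional events, so mu_n > 0
    wherever these occur only finitely often. *)
Lemma ae_ratio_cvg1 d (T : measurableType d) (R : realType)
    (P : probability T R) (X : nat -> {RV P >-> R}) (g : nat -> nat -> R -> R)
    (mu : nat -> R) (c0 : R) :
  mutually_independent X ->
  (forall n k, measurable_fun [set: R] (g n k)) ->
  (forall n k w, 0 <= g n k (X k w) <= 1) ->
  (forall n, mu n = \sum_(k < n) fine (\int[P]_w (g n k (X k w))%:E)%E) ->
  0 < c0 ->
  (forall c, 0 < c < c0 -> (\sum_(1 <= n <oo) (expR (- (c * mu n)))%:E < +oo)%E) ->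
  {ae P, forall w, (\sum_(k < n) g n k (X k w)) / mu n @[n --> \oo] --> (1 : R)}.
Proof.
move=> indX mg g01 muE c00 summ.
have mu0 n : 0 <= mu n.
  rewrite muE; apply: sumr_ge0 => k _.
  have mgX : measurable_fun [set: T] (fun w => g n k (X k w)).
    exact: measurableT_comp.
  by case/andP: (mean_unit_valued P mgX (g01 n k)).
pose S n w := \sum_(k < n) g n k (X k w).
have mS n : measurable_fun [set: T] (S n).
  by apply: measurable_sum => k; exact: measurableT_comp.
(* If l <= q, then l <= 1/2 gives 2 l^2 <= l <= c0 / 4 < c0. *)
pose q := Num.min 2^-1 (c0 / 4).
have q0 : 0 < q by rewrite lt_min invr_gt0 ltr0n /= divr_gt0.
pose l m := q / m.+1%:R.
have l0 m : 0 < l m by rewrite divr_gt0.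
have lq m : l m <= q by rewrite ler_pdivrMr// ler_peMr ?ler1n// ltW.
have l2 m : l m <= 2^-1 by rewrite (le_trans (lq m))// ge_min lexx.
have l4 m : l m <= c0 / 4 by rewrite (le_trans (lq m))// ge_min lexx orbT.
pose F m n := [set w | 4 * l m * mu n <= `|S n w - mu n|].
have mF m n : measurable (F m n).
  rewrite /F -[X in measurable X]setTI; apply: measurable_fun_le => //.
  by apply: measurableT_comp => //; exact: measurable_funB.
have sumF m : (\sum_(n <oo) P (F m n) < +oo)%E.
  rewrite (nneseries_split 0 1)//.
  rewrite big_nat1 add0n lte_add_pinfty//.
    by apply: le_lt_trans (ltry 1); exact: probability_le1.
  have bd n : (P (F m n) <= 2%:E * (expR (- (2 * l m ^+ 2 * mu n)))%:E)%E.
    rewrite -EFinM /F muE.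
    by apply: (chernoff_sum_two_sided n indX (mg n) (g01 n)); rewrite l0 l2.
  apply: le_lt_trans (lee_nneseries _ (fun n _ => bd n)) _.
    by move=> *; exact: measure_ge0.
  rewrite nneseriesZl//.
  rewrite lte_mul_pinfty//; apply: summ.
  have := l0 m; have := l2 m; have := l4 m; move: (l m) => x x1 x2 x3.
  by rewrite mulr_gt0 ?exprn_gt0//= expr2; nra.
have : \forall w \ae P, forall m, ~ lim_sup_set (F m) w.
  apply: ae_foralln => m; exists (lim_sup_set (F m)); split.
  - apply: bigcapT_measurable => n; exact: bigcup_measurable.
  - by apply: lim_sup_set_cvg0 => //; exact: sumF.
  - by move=> w /= /contrapT.
apply: filterS => w wF; apply/cvgrPdist_lt => e e0.
have [m me] : exists m, 4 * l m <= e.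
  exists (Num.truncn (4 * q / e)).
  rewrite /l mulrA ler_pdivrMr// -ler_pdivrMl// ltW//.
  by rewrite mulrC truncnS_gt.
have /existsNP[N /= FN] : ~ forall n, (\bigcup_(j in [set j | (n <= j)%N]) F m j) w.
  by move=> h; apply: (wF m) => n _; exact: h.
exists N => // n /= Nn.
have : ~ F m n w by move=> h; apply: FN; exists n.
rewrite /F /= => /negP; rewrite -ltNge => h.
have mun : 0 < mu n.
  rewrite lt0r mu0 andbT; apply/eqP => mu_eq0; move: h.
  by rewrite mu_eq0 mulr0 ltNge normr_ge0.
apply: lt_le_trans me.
rewrite distrC -(ltr_pM2r mun); apply: le_lt_trans h.
by rewrite -[X in _ * X](gtr0_norm mun) -normrM mulrBl mul1r divfK ?gt_eqF.
Qed.

(** * Trimming a sorted family *)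

Lemma sum_ord_lt1 (R : pzRingType) n r : (r <= n)%N ->
  \sum_(k < n | (k < r)%N) (1 : R) = r%:R.
Proof.
by move=> rn; rewrite -(big_ord_widen n (fun=> 1))// sumr_const card_ord.
Qed.

(** If the entry at position [k] exceeded [t], so would the [k.+1 > r] entries
    at positions up to [k]. *)
Lemma sorted_tail_le (R : realDomainType) (n r : nat) (x : 'I_n -> R) (s : 'S_n)
    (t : R) (k : 'I_n) :
  (forall i j : 'I_n, (i <= j)%N -> x (s j) <= x (s i)) ->
  \sum_(j < n) (t < x j)%R%:R <= r%:R :> R -> (r <= k)%N -> x (s k) <= t.
Proof.
move=> sorted few rk; rewrite leNgt; apply/negP => tk.
have : k.+1%:R <= \sum_(j < n) (t < x j)%R%:R :> R.
  rewrite (reindex_inj (@perm_inj _ s))/= -(sum_ord_lt1 _ (ltn_ord k)) big_mkcond.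
  apply: ler_sum => j _; case: ifP => // jk.
  by rewrite (lt_le_trans tk)// sorted.
by move=> /le_trans/(_ few); rewrite ler_nat ltnNge rk.
Qed.

(** Both bounds concern the entries at the first [r] positions that are at
    most [t]: their sum is what separates the two sums, and there are
    r - #{k | t < x_k} of them. *)
Lemma trimmed_sum_bounds (R : realDomainType) (n r : nat) (x : 'I_n -> R)
    (s : 'S_n) (t : R) :
  (forall k, 0 <= x k) ->
  (forall i j : 'I_n, (i <= j)%N -> x (s j) <= x (s i)) -> (r <= n)%N ->
  \sum_(k < n) (t < x k)%R%:R <= r%:R :> R ->
  let truncated := \sum_(k < n) x k * (x k <= t)%R%:R in
  let trimmed := \sum_(k < n | (r <= k)%N) x (s k) in
  truncated - t * (r%:R - \sum_(k < n) (t < x k)%R%:R) <= trimmed <= truncated.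
Proof.
move=> x_ge0 sorted rn few.
have tail_le (k : 'I_n) (rk : (r <= k)%N) := sorted_tail_le sorted few rk.
rewrite /=; set A := \sum_(k < n | (r <= k)%N) _.
have splitE (F : 'I_n -> R) : \sum_(k < n) F k =
    \sum_(k < n | (r <= k)%N) F (s k) + \sum_(k < n | (k < r)%N) F (s k).
  rewrite (reindex_inj (@perm_inj _ s))/= (bigID (fun k : 'I_n => (r <= k)%N))/=.
  by congr (_ + _); apply: eq_bigl => k; rewrite ltnNge.
rewrite !splitE/=.
have -> : \sum_(k < n | (r <= k)%N) x (s k) * (x (s k) <= t)%R%:R = A.
  by apply: eq_bigr => k /tail_le ->; rewrite mulr1.
have -> : \sum_(k < n | (r <= k)%N) (t < x (s k))%R%:R = 0 :> R.
  by rewrite big1// => k /tail_le; rewrite leNgt => /negbTE ->.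
rewrite add0r; set B := \sum_(k < n | (k < r)%N) x (s k) * _.
have B0 : 0 <= B by apply: sumr_ge0 => k _; rewrite mulr_ge0.
have Bt : B <= t * (r%:R - \sum_(k < n | (k < r)%N) (t < x (s k))%R%:R).
  rewrite -(sum_ord_lt1 R rn) -sumrB mulr_sumr; apply: ler_sum => k _.
  by case: (leP (x (s k)) t) => xt; rewrite ?subr0 ?subrr ?mulr1 ?mulr0.
by apply/andP; split; lra.
Qed.

(** * The deterministic limit *)

Lemma limn_esup_lty_near_le (R : realType) (u : nat -> R) :
  (limn_esup (fun n => (u n)%:E) < +oo)%E -> exists M, \forall n \near \oo, u n <= M.
Proof.
move=> /ereal_inf_lt[_ [V Voo <-]] uV.
exists (fine (ereal_sup [set (u n)%:E | n in V])).
apply: filterS Voo => n Vn.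
have : ((u n)%:E <= ereal_sup [set (u n)%:E | n in V])%E.
  by apply: ereal_sup_ubound; exists n.
by case: (ereal_sup _) uV => // r _; rewrite lee_fin.
Qed.

(** With the convention 1 / 0 = 0, a ratio that tends to 1 has an eventually
    nonzero denominator. *)
Lemma cvg_ratio1_near_gt0 (R : realType) (u v : nat -> R) :
  (forall n, 0 <= v n) -> u n / v n @[n --> \oo] --> (1 : R) ->
  \forall n \near \oo, 0 < v n.
Proof.
move=> v0 uv; near=> n; rewrite lt0r v0 andbT; apply/eqP => vn0.
have : 0 < u n / v n by near: n; exact: (cvgr_gt _ uv).
by rewrite vn0 invr0 mulr0 ltxx.
Unshelve. all: by end_near. Qed.

(** The argument for a single outcome, once the two laws of large numbers hold
    for it. *)
Lemma trimmed_ratio_cvg1 (R : realType) (x : nat -> R) (s : forall n, 'S_n)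
    (r : nat -> nat) (t d A : nat -> R) (eps M : R) :
  (forall k, 0 <= x k) ->
  (forall n (i j : 'I_n), (i <= j)%N -> x (s n j) <= x (s n i)) ->
  (forall n, (0 < n)%N -> (r n <= n)%N) ->
  (forall n, (0 < n)%N -> 0 <= t n) ->
  (forall n, 0 <= d n) -> (forall n, 0 <= A n) -> 0 < eps ->
  (\forall n \near \oo, (1 + eps) * A n <= (r n)%:R) ->
  (\forall n \near \oo, A n * t n / d n <= M) ->
  ((r n)%:R - A n) * t n / d n @[n --> \oo] --> (0 : R) ->
  (\sum_(k < n) x k * (x k <= t n)%R%:R) / d n @[n --> \oo] --> (1 : R) ->
  (\sum_(k < n) (t n < x k)%R%:R) / A n @[n --> \oo] --> (1 : R) ->
  (\sum_(k < n | (r n <= k)%N) x (s n k)) / d n @[n --> \oo] --> (1 : R).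
Proof.
move=> x0 sorted rn t0 d0 A0 eps0 r_ge AtM rAtd ratioT ratioN.
pose N n : R := \sum_(k < n) (t n < x k)%R%:R.
pose S n : R := \sum_(k < n) x k * (x k <= t n)%R%:R.
have d_gt0 := cvg_ratio1_near_gt0 d0 ratioT.
have A_gt0 := cvg_ratio1_near_gt0 A0 ratioN.
pose err n := ((r n)%:R - A n) * t n / d n + `|1 - N n / A n| * M.
have err0 : err n @[n --> \oo] --> (0 : R).
  rewrite -[0]addr0; apply: cvgD => //.
  rewrite -[0](mul0r M); apply: cvgMl; rewrite -(normr0 R) -(subrr 1).
  by apply: cvg_norm; apply: cvgB => //; exact: cvg_cst.
apply: (@squeeze_cvgr _ _ _ _ (fun n => S n / d n - err n) (fun n => S n / d n)).
- near=> n.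
  have n0 : (0 < n)%N by near: n; exact: nbhs_infty_gt.
  have An : 0 < A n by near: n.
  have dn : 0 < d n by near: n.
  have Nr : N n <= (r n)%:R.
    apply: (@le_trans _ _ ((1 + eps) * A n)); last by near: n.
    rewrite -ler_pdivrMr// ltW//; near: n; apply: (cvgr_lt _ ratioN); lra.
  have AtMn : A n * t n / d n <= M by near: n; exact: AtM.
  have /andP[lo hi] := trimmed_sum_bounds (fun k : 'I_n => x0 k) (@sorted n)
    (rn _ n0) Nr.
  apply/andP; split; last by rewrite ler_pM2r ?invr_gt0.
  apply: (@le_trans _ _ ((S n - t n * ((r n)%:R - N n)) / d n)); last first.
    by rewrite ler_pM2r ?invr_gt0.
  rewrite mulrBl lerD2l lerN2 /err.
  have -> : t n * ((r n)%:R - N n) / d n =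
    ((r n)%:R - A n) * t n / d n + (1 - N n / A n) * (A n * t n / d n).
    by field; rewrite !gt_eqF.
  rewrite lerD2l (@le_trans _ _ (`|1 - N n / A n| * (A n * t n / d n)))//.
    by rewrite ler_wpM2r ?ler_norm// divr_ge0 ?mulr_ge0 ?t0.
  by rewrite ler_wpM2l.
- by rewrite -[1]subr0; apply: cvgB.
- exact: ratioT.
Unshelve. all: by end_near. Qed.

Theorem theorem3p3 (R : realType) (disp : measure_display)
    (T : measurableType disp) (P : probability T R)
    (X : nat -> {RV P >-> R})
    (X_ge0 : forall k w, 0 <= X k w)
    (X_indep : mutually_independent X)
    (sigma : forall n : nat, T -> 'S_n)
    (sigma_sorts : forall n, sorts_decreasingly X (sigma n))
    (r : nat -> nat)
    (r_lt : forall n, (0 < n)%N -> (r n < n)%N)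
    (r_infty : r @ \oo --> \oo)
    (r_littleo : (fun n => (r n)%:R : R^o) =o_\oo (fun n => n%:R : R^o))
    (t : nat -> R)
    (t_gt0 : forall n, (0 < n)%N -> 0 < t n) :
  let d := truncated_mean_sum X t in
  let A := tail_prob_sum X t in
  (exists C0 : R, 0 < C0 /\ forall C : R, 0 < C < C0 ->
     (\sum_(1 <= n <oo)
        (expR (- (C * (d n ^+ 2 / (n%:R * t n ^+ 2)))))%:E < +oo)%E) ->
  (exists c0 : R, 0 < c0 /\ forall c : R, 0 < c < c0 ->
     (\sum_(1 <= n <oo) (expR (- (c * A n)))%:E < +oo)%E) ->
  (exists eps0 : R, 0 < eps0 /\
     \forall n \near \oo, Num.ceil ((1 + eps0) * A n) <= (r n)%:Z) ->
  (limn_esup (fun n => (A n * t n / d n)%:E) < +oo)%E ->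
  ((fun n => ((r n)%:R - A n) * t n / d n) @ \oo --> (0 : R)) ->
  {ae P, forall w,
    (fun n => trimmed_sum X (sigma n) (r n) w / d n) @ \oo --> (1 : R)}.
Proof.
move=> d A [C0 [C00 sumC]] [c0 [c00 sumc]] [eps [eps0 r_ge]] Atd rAtd.
(* Dividing by t_n brings the truncated variables into [0, 1]. *)
pose gT n (k : nat) (x : R) : R := x * \1_[set y | y <= t n] x / t n.
pose gN n (k : nat) (x : R) : R := \1_[set y | t n < y] x.
have mle a : measurable [set y : R | y <= a].
  by rewrite -[X in measurable X]setTI; exact: measurable_fun_le.
have mgt a : measurable [set y : R | a < y].
  rewrite (_ : [set y | _] = ~` [set y | y <= a]); first exact: measurableC.
  by apply/seteqP; split => y /=; rewrite ltNge => /negP.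
have mgT n k : measurable_fun [set: R] (gT n k).
  apply: measurable_funM => //; apply: measurable_funM => //;
    exact: measurable_indic.
have mgN n k : measurable_fun [set: R] (gN n k) by exact: measurable_indic.
have gT01 n k w : 0 <= gT n k (X k w) <= 1.
  rewrite /gT indicE; have [|_] := boolP (_ \in _); last first.
    by rewrite mulr0 mul0r lexx ler01.
  rewrite inE /= mulr1 => Xt.
  have tn0 : 0 <= t n by exact: le_trans (X_ge0 k w) Xt.
  (* When t_n = 0, the quotient is 0 by the convention 1 / 0 = 0. *)
  rewrite divr_ge0//=; move: tn0; rewrite le_eqVlt => /orP[/eqP <-|tn0].
    by rewrite invr0 mulr0.
  by rewrite ler_pdivrMr// mul1r.
have gN01 n k w : 0 <= gN n k (X k w) <= 1.
  by rewrite /gN indicE; case: (_ \in _); rewrite lexx ler01.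
have mgTX n k : measurable_fun [set: T] (fun w => gT n k (X k w)).
  exact: measurableT_comp.
have muT01 n k := mean_unit_valued P (mgTX n k) (gT01 n k).
pose muT n := \sum_(k < n) fine (\int[P]_w (gT n k (X k w))%:E)%E.
have muT0 n : 0 <= muT n by apply: sumr_ge0 => k _; case/andP: (muT01 n k).
have muTn n : muT n <= n%:R.
  rewrite -[n in n%:R]card_ord -sumr_const; apply: ler_sum => k _.
  by case/andP: (muT01 n k).
have d_muT n : (0 < n)%N -> d n = t n * muT n.
  move=> n0; rewrite /d /truncated_mean_sum mulr_sumr; apply: eq_bigr => k _.
  rewrite unlock -[t n in RHS]/(fine (t n)%:E) -fineM//; last first.
    by apply: integral_fune_fin_num => //; exact: integrable_unit_valued.
  rewrite -ge0_integralZl//.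
  - congr fine; apply: eq_integral => w _; rewrite -EFinM; congr EFin.
    by rewrite /gT mulrCA mulfV ?mulr1 ?gt_eqF ?t_gt0.
  - exact/measurable_EFinP.
  - by move=> w _; rewrite lee_fin; case/andP: (gT01 n k w).
  - by rewrite lee_fin ltW ?t_gt0.
have A_mean n : A n = \sum_(k < n) fine (\int[P]_w (gN n k (X k w))%:E)%E.
  by apply: eq_bigr => k _; rewrite integral_indic_comp.
have sumT c : 0 < c < C0 ->
    (\sum_(1 <= n <oo) (expR (- (c * muT n)))%:E < +oo)%E.
  move=> /andP[c_gt0 cC]; apply: le_lt_trans (sumC c _); last by rewrite c_gt0.
  apply: lee_nneseries => [n _ _|n _]; first by rewrite lee_fin expR_ge0.
  rewrite lee_fin ler_expR lerN2 ler_pM2l//.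
  have [->|n0] := posnP n; first by rewrite mul0r invr0 mulr0.
  rewrite d_muT// ler_pdivrMr ?mulr_gt0 ?exprn_gt0 ?t_gt0 ?ltr0n//.
  rewrite exprMn mulrC [leRHS]mulrA ler_pM2r ?exprn_gt0 ?t_gt0// expr2.
  by rewrite ler_wpM2l.
have aeT := ae_ratio_cvg1 X_indep mgT gT01 (fun=> erefl) C00 sumT.
have aeN := ae_ratio_cvg1 X_indep mgN gN01 A_mean c00 sumc.
have [M AtM] := limn_esup_lty_near_le Atd.
move: aeT aeN; apply: filterS2 => w; rewrite -/muT => ratioT ratioN.
apply: (trimmed_ratio_cvg1 (x := fun k => X k w) (s := fun n => sigma n w)
  (A := A) (t := t) (eps := eps) (M := M)) => //.
- by move=> n i j; exact: sigma_sorts.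
- by move=> n /r_lt/ltnW.
- by move=> n /t_gt0/ltW.
- move=> n; apply: sumr_ge0 => k _; rewrite fine_ge0// expectation_ge0// => w'.
  by rewrite mulr_ge0.
- by move=> n; apply: sumr_ge0 => k _; exact: fine_ge0.
- apply: filterS r_ge => n rn; apply: le_trans (ceil_ge _) _.
  by rewrite -[(r n)%:R]/((r n)%:Z%:~R) ler_int.
- apply: cvg_trans ratioT; apply: near_eq_cvg; near=> n.
  have n0 : (0 < n)%N by near: n; exact: nbhs_infty_gt.
  rewrite d_muT// invfM mulrA; congr (_ / _).
  rewrite mulr_suml; apply: eq_bigr => k _; rewrite /gT indicE.
  by congr (_ * _%:R * _); rewrite mem_setE.
- rewrite (_ : (fun n => _) = fun n => (\sum_(k < n) gN n k (X k w)) / A n)//.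
  apply/funext => n; congr (_ / _); apply: eq_bigr => k _.
  by rewrite /gN indicE mem_setE.
Unshelve. all: by end_near. Qed.
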